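(* Let $J\colon\mathcal A\to\mathcal E$ be a pseudofunctor between bicategories, let $T$ be a $J$-relative pseudomonad, let $(A,(-)^a,\hat a,\tilde a)$ and $(B,(-)^b,\hat b,\tilde b)$ be $T$-pseudoalgebras, and let $\ell\dashv r$ be an adjunction in $\mathcal E$ with $\ell\colon A\to B$, $r\colon B\to A$, unit $\nu\colon 1_A\Rightarrow r\ell$ and counit $\varepsilon\colon\ell r\Rightarrow 1_B$. Let $\overline\ell$ be a colax morphism structure on $\ell$ and $\overline r$ a lax morphism structure on $r$ corresponding to one another under taking mates. Then: (1) the adjunction $\ell\dashv r$ lifts to $\mathrm{PsAlg}_l(T)$ if and only if $\overline\ell$ is invertible, i.e. $(\ell,\overline\ell)$ is a pseudomorphism from $A$ to $B$; (2) the adjunction $\ell\dashv r$ lifts to $\mathrm{PsAlg}_c(T)$ if and only if $\overline r$ is invertible, i.e. $(r,\overline r)$ is a pseudomorphism from $B$ to $A$. Moreover, in each case the inverse is constructed by taking mates: in (1), the lax morphism structure on $\ell$ in the lifted adjunction is invertible with inverse the mate $\overline\ell$ of $\overline r$; in (2), the colax morphism structure on $r$ in the lifted adjunction is invertible with inverse the mate $\overline r$ of $\overline\ell$.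
   Context: Conventions. For a bicategory $\mathcal E$, $\mathcal E[X,Y]$ is the hom-category; composition of 1-cells and whiskering are written by juxtaposition, vertical composition of 2-cells by $\circ$; structural isomorphisms (associators, unitors, pseudofunctor constraints) are left implicit in equations or written $\cong$. A $J$-relative pseudomonad $T$ comprises: an object $TX\in\mathcal E$ for each $X\in\mathcal A$; functors $(-)^*\colon\mathcal E[JX,TY]\to\mathcal E[TX,TY]$ for $X,Y\in\mathcal A$; 1-cells $i_X\colon JX\to TX$; invertible 2-cells $\mu_{g,f}\colon(g^*f)^*\Rightarrow g^*f^*$ natural in $f\colon JX\to TY$, $g\colon JY\to TZ$; invertible 2-cells $\eta_f\colon f\Rightarrow f^*i_X$ natural in $f\colon JX\to TY$; invertible 2-cells $\theta_X\colon(i_X)^*\Rightarrow 1_{TX}$; such that $(\mu_{h,g}f^* )\circ\mu_{h^*g,f}=(h^*\mu_{g,f})\circ\mu_{h,g^*f}\circ(\mu_{h,g}f)^*$ for all $f\colon JW\to TX$, $g\colon JX\to TY$, $h\colon JY\to TZ$, and $(f^*\theta_X)\circ\mu_{f,i_X}\circ(\eta_f)^*$ is the structural isomorphism $f^*\cong f^*1_{TX}$ for all $f\colon JX\to TY$. A $T$-pseudoalgebra $(A,(-)^a,\hat a,\tilde a)$ comprises: an object $A\in\mathcal E$; functors $(-)^a\colon\mathcal E[JX,A]\to\mathcal E[TX,A]$ for $X\in\mathcal A$; invertible 2-cells $\hat a_{g,f}\colon(g^af)^a\Rightarrow g^af^*$ natural in $f\colon JX\to TY$, $g\colon JY\to A$;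 invertible 2-cells $\tilde a_f\colon f\Rightarrow f^ai_X$ natural in $f\colon JX\to A$; such that $(\hat a_{h,g}f^* )\circ\hat a_{h^ag,f}=(h^a\mu_{g,f})\circ\hat a_{h,g^*f}\circ(\hat a_{h,g}f)^a$ for all $f\colon JX\to TY$, $g\colon JY\to TZ$, $h\colon JZ\to A$, and $(f^a\theta_X)\circ\hat a_{f,i_X}\circ(\tilde a_f)^a$ is the structural isomorphism $f^a\cong f^a1_{TX}$ for all $f\colon JX\to A$. A lax morphism structure on a 1-cell $h\colon A\to B$ between pseudoalgebras is a family of 2-cells $\overline h_f\colon(hf)^b\Rightarrow hf^a$ natural in $f\colon JX\to A$ such that $(h\hat a_{g,f})\circ\overline h_{g^af}\circ(\overline h_gf)^b=(\overline h_gf^* )\circ\hat b_{hg,f}$ for all $f\colon JX\to TY$, $g\colon JY\to A$, and $(\overline h_fi_X)\circ\tilde b_{hf}=h\tilde a_f$. A colax morphism structure is a family of 2-cells $\overline h_f\colon hf^a\Rightarrow(hf)^b$ natural in $f$ such that $\hat b_{hg,f}\circ(\overline h_gf)^b\circ\overline h_{g^af}=(\overline h_gf^* )\circ(h\hat a_{g,f})$ and $(\overline h_fi_X)\circ(h\tilde a_f)=\tilde b_{hf}$. A pseudomorphism is a lax (equivalently, by inverting, colax) morphism with invertible 2-cells. A transformation of lax morphisms is a 2-cell $\alpha\colon h\Rightarrow h'$ with $\overline{h'}_f\circ(\alpha f)^b=(\alpha f^a)\circ\overline h_f$ for all $f$; of colax morphisms, one with $(\alpha f)^b\circ\overline h_f=\overline{h'}_f\circ(\alpha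 f^a)$. $\mathrm{PsAlg}_l(T)$ (resp. $\mathrm{PsAlg}_c(T)$) is the bicategory of $T$-pseudoalgebras, lax (resp. colax) morphisms and transformations; in the lax case identities are $1_A$ with $(1_Af)^a\cong f^a\cong1_Af^a$ and composites are $h'h$ with $((h'h)f)^c\cong(h'(hf))^c\xrightarrow{\overline{h'}_{hf}}h'(hf)^b\xrightarrow{h'\overline h_f}h'(hf^a)\cong(h'h)f^a$, the rest being as in $\mathcal E$; the colax case is analogous. Taking mates gives a bijection between colax structures $\overline\ell$ on $\ell$ and lax structures $\overline r$ on $r$: $\overline\ell_f=(\varepsilon(\ell f)^b)\circ(\ell\,\overline r_{\ell f})\circ(\ell(\nu f)^a)$ for $f\colon JX\to A$, and $\overline r_g=(r(\varepsilon g)^b)\circ(r\,\overline\ell_{rg})\circ(\nu(rg)^a)$ for $g\colon JX\to B$. ''The adjunction lifts to $\mathrm{PsAlg}_l(T)$'' means that $\ell$ admits a lax morphism structure such that, together with $(r,\overline r)$, the 2-cells $\nu$ and $\varepsilon$ are transformations and hence form the unit and counit of an adjunction in $\mathrm{PsAlg}_l(T)$. ''Lifts to $\mathrm{PsAlg}_c(T)$'' means that $r$ admits a colax morphism structure such that, together with $(\ell,\overline\ell)$, $\nu$ and $\varepsilon$ are transformations, forming an adjunction in $\mathrm{PsAlg}_c(T)$. *)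

(* Defs.v *)
From Stdlib Require Import ssreflect ssrfun ProofIrrelevance.

Set Implicit Arguments.
Unset Strict Implicit.
Unset Printing Implicit Defensive.

Declare Scope bicat_scope.
Delimit Scope bicat_scope with bicat.
Local Open Scope bicat_scope.

Record Category := {
  cob :> Type;
  mor : cob -> cob -> Type;
  idm : forall x, mor x x;
  compm : forall x y z, mor y z -> mor x y -> mor x z;
  compm1 : forall x y (u : mor x y), compm u (idm x) = u;
  comp1m : forall x y (u : mor x y), compm (idm y) u = u;
  compmA : forall x y z w (t : mor z w) (v : mor y z) (u : mor x y),
    compm (compm t v) u = compm t (compm v u) }.

Arguments mor {c} _ _.
Arguments idm {c} _.
Arguments compm {c x y z} _ _.
Arguments compm1 {c x y} _.
Arguments comp1m {c x y} _.
Arguments compmA {c x y z w} _ _ _.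

Notation "f ⇒ g" := (mor f g) (at level 70, no associativity) : bicat_scope.
Notation "v ∘ u" := (compm v u) (at level 43, right associativity) : bicat_scope.

Definition inverse_of (C : Category) (x y : C) (u : x ⇒ y) (v : y ⇒ x) : Prop :=
  v ∘ u = idm x /\ u ∘ v = idm y.

Definition invertible (C : Category) (x y : C) (u : x ⇒ y) : Prop :=
  exists v : y ⇒ x, inverse_of u v.

Record Iso (C : Category) (x y : C) := {
  iso_mor :> x ⇒ y;
  iso_inv : y ⇒ x;
  iso_inv_mor : iso_inv ∘ iso_mor = idm x;
  iso_mor_inv : iso_mor ∘ iso_inv = idm y }.

Notation "f ≅ g" := (Iso f g) (at level 70, no associativity) : bicat_scope.
Notation "u ^-1" := (iso_inv u) (at level 3, format "u ^-1") : bicat_scope.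

Record Functor (C D : Category) := {
  fobj :> C -> D;
  fmor : forall x y, x ⇒ y -> fobj x ⇒ fobj y;
  fmor_id : forall x, fmor (idm x) = idm (fobj x);
  fmor_comp : forall x y z (v : y ⇒ z) (u : x ⇒ y), fmor (v ∘ u) = fmor v ∘ fmor u }.

Arguments fmor {C D} _ {x y} _.

(* Horizontal composition is presented by composition of 1-cells together with
   the two whiskerings and the interchange law. *)

Reserved Notation "g · f" (at level 36, left associativity).
Reserved Notation "g ◁ a" (at level 37, no associativity).
Reserved Notation "b ▷ f" (at level 37, no associativity).

Record Bicategory := {
  ob :> Type;
  hom : ob -> ob -> Category;
  id1 : forall X, hom X X;
  comp1 : forall X Y Z, hom Y Z -> hom X Y -> hom X Z
    where "g · f" := (comp1 g f);
  lwhisk : forall X Y Z (g : hom Y Z) (f f' : hom X Y), f ⇒ f' -> g · f ⇒ g · f'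
    where "g ◁ a" := (lwhisk g a);
  rwhisk : forall X Y Z (g g' : hom Y Z), g ⇒ g' -> forall f : hom X Y, g · f ⇒ g' · f
    where "b ▷ f" := (rwhisk b f);
  assoc : forall X Y Z W (h : hom Z W) (g : hom Y Z) (f : hom X Y),
    (h · g) · f ≅ h · (g · f);
  lunit : forall X Y (f : hom X Y), id1 Y · f ≅ f;
  runit : forall X Y (f : hom X Y), f · id1 X ≅ f;
  lwhisk_id : forall X Y Z (g : hom Y Z) (f : hom X Y), g ◁ idm f = idm (g · f);
  lwhisk_comp : forall X Y Z (g : hom Y Z) (f f' f'' : hom X Y) (a' : f' ⇒ f'') (a : f ⇒ f'),
    g ◁ (a' ∘ a) = (g ◁ a') ∘ (g ◁ a);
  rwhisk_id : forall X Y Z (g : hom Y Z) (f : hom X Y), idm g ▷ f = idm (g · f);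
  rwhisk_comp : forall X Y Z (g g' g'' : hom Y Z) (b' : g' ⇒ g'') (b : g ⇒ g') (f : hom X Y),
    (b' ∘ b) ▷ f = (b' ▷ f) ∘ (b ▷ f);
  interchange : forall X Y Z (g g' : hom Y Z) (f f' : hom X Y) (b : g ⇒ g') (a : f ⇒ f'),
    (b ▷ f') ∘ (g ◁ a) = (g' ◁ a) ∘ (b ▷ f);
  assoc_lwhisk : forall X Y Z W (h : hom Z W) (g : hom Y Z) (f f' : hom X Y) (a : f ⇒ f'),
    assoc h g f' ∘ ((h · g) ◁ a) = (h ◁ (g ◁ a)) ∘ assoc h g f;
  assoc_mwhisk : forall X Y Z W (h : hom Z W) (g g' : hom Y Z) (b : g ⇒ g') (f : hom X Y),
    assoc h g' f ∘ ((h ◁ b) ▷ f) = (h ◁ (b ▷ f)) ∘ assoc h g f;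
  assoc_rwhisk : forall X Y Z W (h h' : hom Z W) (c : h ⇒ h') (g : hom Y Z) (f : hom X Y),
    assoc h' g f ∘ ((c ▷ g) ▷ f) = (c ▷ (g · f)) ∘ assoc h g f;
  lunit_nat : forall X Y (f f' : hom X Y) (a : f ⇒ f'),
    lunit f' ∘ (id1 Y ◁ a) = a ∘ lunit f;
  runit_nat : forall X Y (f f' : hom X Y) (a : f ⇒ f'),
    runit f' ∘ (a ▷ id1 X) = a ∘ runit f;
  pentagon : forall V X Y Z W (k : hom Z W) (h : hom Y Z) (g : hom X Y) (f : hom V X),
    (k ◁ assoc h g f) ∘ assoc k (h · g) f ∘ (assoc k h g ▷ f)
    = assoc k h (g · f) ∘ assoc (k · h) g f;
  triangle : forall X Y Z (g : hom Y Z) (f : hom X Y),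
    (g ◁ lunit f) ∘ assoc g (id1 Y) f = runit g ▷ f }.

Arguments hom {_} _ _.
Arguments id1 {_} _.
Arguments comp1 {_ X Y Z} _ _.
Arguments lwhisk {_ X Y Z} _ {f f'} _.
Arguments rwhisk {_ X Y Z g g'} _ _.
Arguments assoc {_ X Y Z W} _ _ _.
Arguments lunit {_ X Y} _.
Arguments runit {_ X Y} _.

Notation "g · f" := (comp1 g f) : bicat_scope.
Notation "g ◁ a" := (lwhisk g a) : bicat_scope.
Notation "b ▷ f" := (rwhisk b f) : bicat_scope.

Record Pseudofunctor (C D : Bicategory) := {
  pobj :> C -> D;
  pfun : forall X Y, Functor (@hom C X Y) (hom (pobj X) (pobj Y));
  pid : forall X, id1 (pobj X) ≅ pfun X X (id1 X);
  pcomp : forall X Y Z (g : hom Y Z) (f : hom X Y),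
    pfun Y Z g · pfun X Y f ≅ pfun X Z (g · f);
  pcomp_lwhisk : forall X Y Z (g : hom Y Z) (f f' : hom X Y) (a : f ⇒ f'),
    pcomp g f' ∘ (pfun Y Z g ◁ fmor (pfun X Y) a) = fmor (pfun X Z) (g ◁ a) ∘ pcomp g f;
  pcomp_rwhisk : forall X Y Z (g g' : hom Y Z) (b : g ⇒ g') (f : hom X Y),
    pcomp g' f ∘ (fmor (pfun Y Z) b ▷ pfun X Y f) = fmor (pfun X Z) (b ▷ f) ∘ pcomp g f;
  pcomp_assoc : forall X Y Z W (h : hom Z W) (g : hom Y Z) (f : hom X Y),
    fmor (pfun X W) (assoc h g f) ∘ pcomp (h · g) f ∘ (pcomp h g ▷ pfun X Y f)
    = pcomp h (g · f) ∘ (pfun Z W h ◁ pcomp g f)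
      ∘ assoc (pfun Z W h) (pfun Y Z g) (pfun X Y f);
  pcomp_lunit : forall X Y (f : hom X Y),
    fmor (pfun X Y) (lunit f) ∘ pcomp (id1 Y) f ∘ (pid Y ▷ pfun X Y f) = lunit (pfun X Y f);
  pcomp_runit : forall X Y (f : hom X Y),
    fmor (pfun X Y) (runit f) ∘ pcomp f (id1 X) ∘ (pfun X Y f ◁ pid X) = runit (pfun X Y f) }.

Record Adjunction (K : Bicategory) (X Y : K) (l : hom X Y) (r : hom Y X) := {
  unit : id1 X ⇒ r · l;
  counit : l · r ⇒ id1 Y;
  adj_triangle_l :
    lunit l ∘ (counit ▷ l) ∘ (assoc l r l)^-1 ∘ (l ◁ unit) ∘ (runit l)^-1 = idm l;
  adj_triangle_r :
    runit r ∘ (r ◁ counit) ∘ assoc r l r ∘ (unit ▷ r) ∘ (lunit r)^-1 = idm r }.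

Record RelPseudomonad (D E : Bicategory) (J : Pseudofunctor D E) := {
  tobj :> D -> E;
  ext : forall X Y, Functor (hom (J X) (tobj Y)) (hom (tobj X) (tobj Y));
  tunit : forall X, hom (J X) (tobj X);
  mu : forall X Y Z (g : hom (J Y) (tobj Z)) (f : hom (J X) (tobj Y)),
    ext X Z (ext Y Z g · f) ≅ ext Y Z g · ext X Y f;
  eta : forall X Y (f : hom (J X) (tobj Y)), f ≅ ext X Y f · tunit X;
  theta : forall X, ext X X (tunit X) ≅ id1 (tobj X);
  mu_natl : forall X Y Z (g g' : hom (J Y) (tobj Z)) (b : g ⇒ g') (f : hom (J X) (tobj Y)),
    mu g' f ∘ fmor (ext X Z) (fmor (ext Y Z) b ▷ f)
    = (fmor (ext Y Z) b ▷ ext X Y f) ∘ mu g f;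
  mu_natr : forall X Y Z (g : hom (J Y) (tobj Z)) (f f' : hom (J X) (tobj Y)) (a : f ⇒ f'),
    mu g f' ∘ fmor (ext X Z) (ext Y Z g ◁ a)
    = (ext Y Z g ◁ fmor (ext X Y) a) ∘ mu g f;
  eta_nat : forall X Y (f f' : hom (J X) (tobj Y)) (a : f ⇒ f'),
    eta f' ∘ a = (fmor (ext X Y) a ▷ tunit X) ∘ eta f;
  mu_assoc : forall W X Y Z
      (h : hom (J Y) (tobj Z)) (g : hom (J X) (tobj Y)) (f : hom (J W) (tobj X)),
    assoc (ext Y Z h) (ext X Y g) (ext W X f) ∘ (mu h g ▷ ext W X f) ∘ mu (ext Y Z h · g) f
    = (ext Y Z h ◁ mu g f) ∘ mu h (ext X Y g · f)
      ∘ fmor (ext W Z) (assoc (ext Y Z h) (ext X Y g) f) ∘ fmor (ext W Z) (mu h g ▷ f);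
  mu_unit : forall X Y (f : hom (J X) (tobj Y)),
    (ext X Y f ◁ theta X) ∘ mu f (tunit X) ∘ fmor (ext X Y) (eta f) = (runit (ext X Y f))^-1 }.

Arguments ext {D E J} _ {X Y}.
Arguments tunit {D E J} _ _.
Arguments mu {D E J} _ {X Y Z} _ _.
Arguments eta {D E J} _ {X Y} _.
Arguments theta {D E J} _ _.

Record Pseudoalgebra (D E : Bicategory) (J : Pseudofunctor D E) (T : RelPseudomonad J) := {
  carrier :> E;
  aext : forall X, Functor (hom (J X) carrier) (hom (T X) carrier);
  ahat : forall X Y (g : hom (J Y) carrier) (f : hom (J X) (T Y)),
    aext X (aext Y g · f) ≅ aext Y g · ext T f;
  atilde : forall X (f : hom (J X) carrier), f ≅ aext X f · tunit T X;
  ahat_natl : forall X Y (g g' : hom (J Y) carrier) (b : g ⇒ g') (f : hom (J X) (T Y)),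
    ahat g' f ∘ fmor (aext X) (fmor (aext Y) b ▷ f) = (fmor (aext Y) b ▷ ext T f) ∘ ahat g f;
  ahat_natr : forall X Y (g : hom (J Y) carrier) (f f' : hom (J X) (T Y)) (a : f ⇒ f'),
    ahat g f' ∘ fmor (aext X) (aext Y g ◁ a) = (aext Y g ◁ fmor (ext T) a) ∘ ahat g f;
  atilde_nat : forall X (f f' : hom (J X) carrier) (a : f ⇒ f'),
    atilde f' ∘ a = (fmor (aext X) a ▷ tunit T X) ∘ atilde f;
  ahat_assoc : forall X Y Z
      (h : hom (J Z) carrier) (g : hom (J Y) (T Z)) (f : hom (J X) (T Y)),
    assoc (aext Z h) (ext T g) (ext T f) ∘ (ahat h g ▷ ext T f) ∘ ahat (aext Z h · g) f
    = (aext Z h ◁ mu T g f) ∘ ahat h (ext T g · f)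
      ∘ fmor (aext X) (assoc (aext Z h) (ext T g) f) ∘ fmor (aext X) (ahat h g ▷ f);
  ahat_unit : forall X (f : hom (J X) carrier),
    (aext X f ◁ theta T X) ∘ ahat f (tunit T X) ∘ fmor (aext X) (atilde f)
    = (runit (aext X f))^-1 }.

Arguments aext {D E J T} _ {X}.
Arguments ahat {D E J T} _ {X Y} _ _.
Arguments atilde {D E J T} _ {X} _.

Section Morphisms.

Variables (D E : Bicategory) (J : Pseudofunctor D E) (T : RelPseudomonad J).

Record LaxStructure (A B : Pseudoalgebra T) (h : hom A B) := {
  lax_cell :> forall X (f : hom (J X) A), aext B (h · f) ⇒ h · aext A f;
  lax_nat : forall X (f f' : hom (J X) A) (a : f ⇒ f'),
    lax_cell f' ∘ fmor (aext B) (h ◁ a) = (h ◁ fmor (aext A) a) ∘ lax_cell f;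
  lax_hat : forall X Y (g : hom (J Y) A) (f : hom (J X) (T Y)),
    (h ◁ ahat A g f) ∘ lax_cell (aext A g · f)
      ∘ fmor (aext B) (assoc h (aext A g) f) ∘ fmor (aext B) (lax_cell g ▷ f)
    = assoc h (aext A g) (ext T f) ∘ (lax_cell g ▷ ext T f) ∘ ahat B (h · g) f;
  lax_tilde : forall X (f : hom (J X) A),
    assoc h (aext A f) (tunit T X) ∘ (lax_cell f ▷ tunit T X) ∘ atilde B (h · f)
    = h ◁ atilde A f }.

Record ColaxStructure (A B : Pseudoalgebra T) (h : hom A B) := {
  colax_cell :> forall X (f : hom (J X) A), h · aext A f ⇒ aext B (h · f);
  colax_nat : forall X (f f' : hom (J X) A) (a : f ⇒ f'),
    colax_cell f' ∘ (h ◁ fmor (aext A) a) = fmor (aext B) (h ◁ a) ∘ colax_cell f;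
  colax_hat : forall X Y (g : hom (J Y) A) (f : hom (J X) (T Y)),
    ahat B (h · g) f ∘ fmor (aext B) (colax_cell g ▷ f)
      ∘ fmor (aext B) ((assoc h (aext A g) f)^-1) ∘ colax_cell (aext A g · f)
    = (colax_cell g ▷ ext T f) ∘ (assoc h (aext A g) (ext T f))^-1 ∘ (h ◁ ahat A g f);
  colax_tilde : forall X (f : hom (J X) A),
    (colax_cell f ▷ tunit T X) ∘ (assoc h (aext A f) (tunit T X))^-1 ∘ (h ◁ atilde A f)
    = atilde B (h · f) }.

Definition lax_is_pseudo A B h (s : @LaxStructure A B h) : Prop :=
  forall X (f : hom (J X) A), invertible (s X f).

Definition colax_is_pseudo A B h (s : @ColaxStructure A B h) : Prop :=
  forall X (f : hom (J X) A), invertible (s X f).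

Record LaxMorphism (A B : Pseudoalgebra T) := MkLaxMorphism {
  lax_1cell :> hom A B;
  lax_str : LaxStructure lax_1cell }.

Record ColaxMorphism (A B : Pseudoalgebra T) := MkColaxMorphism {
  colax_1cell :> hom A B;
  colax_str : ColaxStructure colax_1cell }.

Record LaxTransformation (A B : Pseudoalgebra T) (h h' : LaxMorphism A B) := {
  laxtr_cell :> lax_1cell h ⇒ lax_1cell h';
  laxtr_law : forall X (f : hom (J X) A),
    lax_str h' X f ∘ fmor (aext B) (laxtr_cell ▷ f) = (laxtr_cell ▷ aext A f) ∘ lax_str h X f }.

Record ColaxTransformation (A B : Pseudoalgebra T) (h h' : ColaxMorphism A B) := {
  colaxtr_cell :> colax_1cell h ⇒ colax_1cell h';
  colaxtr_law : forall X (f : hom (J X) A),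
    fmor (aext B) (colaxtr_cell ▷ f) ∘ colax_str h X f
    = colax_str h' X f ∘ (colaxtr_cell ▷ aext A f) }.

End Morphisms.

Lemma ra (C : Category) (x y z w : C) (v : y ⇒ z) (u : x ⇒ y) (t : x ⇒ z) :
  v ∘ u = t -> forall k : w ⇒ x, v ∘ u ∘ k = t ∘ k.
Proof. by move=> <- k; rewrite compmA. Qed.

Lemma ra3 (C : Category) (x y y' z w : C) (v : y ⇒ z) (s : y' ⇒ y) (u : x ⇒ y') (t : x ⇒ z) :
  v ∘ s ∘ u = t -> forall k : w ⇒ x, v ∘ s ∘ u ∘ k = t ∘ k.
Proof. by move=> <- k; rewrite !compmA. Qed.

Lemma iso_monic (C : Category) (x y z : C) (i : y ≅ z) (u v : x ⇒ y) :
  i ∘ u = i ∘ v -> u = v.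
Proof.
move=> e; rewrite -(comp1m u) -(comp1m v) -(iso_inv_mor i) !compmA.
by rewrite e.
Qed.

Lemma iso_epic (C : Category) (x y z : C) (i : x ≅ y) (u v : y ⇒ z) :
  u ∘ i = v ∘ i -> u = v.
Proof.
move=> e; rewrite -(compm1 u) -(compm1 v) -(iso_mor_inv i) -!compmA.
by rewrite e.
Qed.

Definition iso_sym (C : Category) (x y : C) (i : x ≅ y) : y ≅ x :=
  Build_Iso (iso_mor_inv i) (iso_inv_mor i).

Definition iso_fmor (C C' : Category) (F : Functor C C') (x y : C) (i : x ≅ y) : F x ≅ F y.
Proof.
refine (@Build_Iso _ _ _ (fmor F i) (fmor F i^-1) _ _).
- by rewrite -fmor_comp iso_inv_mor fmor_id.
- by rewrite -fmor_comp iso_mor_inv fmor_id.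
Defined.

Section BicatLemmas.

Variable K : Bicategory.

Definition iso_lwhisk (X Y Z : K) (g : hom Y Z) (f f' : hom X Y) (i : f ≅ f') :
  g · f ≅ g · f'.
Proof.
refine (@Build_Iso _ _ _ (g ◁ i) (g ◁ i^-1) _ _).
- by rewrite -lwhisk_comp iso_inv_mor lwhisk_id.
- by rewrite -lwhisk_comp iso_mor_inv lwhisk_id.
Defined.

Definition iso_rwhisk (X Y Z : K) (g g' : hom Y Z) (i : g ≅ g') (f : hom X Y) :
  g · f ≅ g' · f.
Proof.
refine (@Build_Iso _ _ _ (i ▷ f) (i^-1 ▷ f) _ _).
- by rewrite -rwhisk_comp iso_inv_mor rwhisk_id.
- by rewrite -rwhisk_comp iso_mor_inv rwhisk_id.
Defined.

Lemma lunit_faithful (X Y : K) (f f' : hom X Y) (a b : f ⇒ f') :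
  id1 Y ◁ a = id1 Y ◁ b -> a = b.
Proof.
by move=> e; apply: (iso_epic (i := lunit f)); rewrite -!lunit_nat e.
Qed.

Lemma runit_faithful (X Y : K) (f f' : hom X Y) (a b : f ⇒ f') :
  a ▷ id1 X = b ▷ id1 X -> a = b.
Proof.
by move=> e; apply: (iso_epic (i := runit f)); rewrite -!runit_nat e.
Qed.

Lemma lunit_assoc (X Y Z : K) (g : hom Y Z) (f : hom X Y) :
  lunit (g · f) ∘ assoc (id1 Z) g f = lunit g ▷ f.
Proof.
apply: lunit_faithful.
apply: (iso_epic (i := assoc (id1 Z) (id1 Z · g) f)).
apply: (iso_epic (i := iso_rwhisk (assoc (id1 Z) (id1 Z) g) f)) => /=.
rewrite lwhisk_comp !compmA pentagon (ra (triangle _ _)) -assoc_rwhisk.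
by rewrite -triangle rwhisk_comp (ra (assoc_mwhisk _ _ _)) compmA.
Qed.

Lemma runit_assoc (X Y Z : K) (g : hom Y Z) (f : hom X Y) :
  (g ◁ runit f) ∘ assoc g f (id1 X) = runit (g · f).
Proof.
apply: runit_faithful.
rewrite rwhisk_comp -(triangle (g · f)).
apply: (iso_monic (i := assoc g f (id1 X))).
rewrite (ra (assoc_mwhisk _ _ _)) (ra (assoc_lwhisk _ _ _)) !compmA -pentagon.
by rewrite -triangle lwhisk_comp compmA.
Qed.

End BicatLemmas.

Lemma iso_square (C : Category) (x x' y y' : C) (i : x ≅ x') (i' : y ≅ y')
    (a : x ⇒ y) (b : x' ⇒ y') :
  i' ∘ a = b ∘ i -> a ∘ i^-1 = i'^-1 ∘ b.
Proof.
move=> e; apply: (iso_monic (i := i')); apply: (iso_epic (i := i)).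
by rewrite !compmA iso_inv_mor compm1 e (ra (iso_mor_inv i')) comp1m.
Qed.

Section InverseLemmas.

Variable K : Bicategory.

Lemma inv_lunit_nat (X Y : K) (f f' : hom X Y) (a : f ⇒ f') :
  (id1 Y ◁ a) ∘ (lunit f)^-1 = (lunit f')^-1 ∘ a.
Proof. exact: iso_square (lunit_nat a). Qed.

Lemma inv_assoc_lwhisk X Y Z W (h : hom Z W) (g : hom Y Z) (f f' : @hom K X Y) (a : f ⇒ f') :
  ((h · g) ◁ a) ∘ (assoc h g f)^-1 = (assoc h g f')^-1 ∘ (h ◁ (g ◁ a)).
Proof. exact: iso_square (assoc_lwhisk h g a). Qed.

Lemma inv_assoc_mwhisk X Y Z W (h : hom Z W) (g g' : hom Y Z) (b : g ⇒ g') (f : @hom K X Y) :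
  ((h ◁ b) ▷ f) ∘ (assoc h g f)^-1 = (assoc h g' f)^-1 ∘ (h ◁ (b ▷ f)).
Proof. exact: iso_square (assoc_mwhisk h b f). Qed.

Lemma inv_assoc_rwhisk X Y Z W (h h' : hom Z W) (c : h ⇒ h') (g : hom Y Z) (f : @hom K X Y) :
  ((c ▷ g) ▷ f) ∘ (assoc h g f)^-1 = (assoc h' g f)^-1 ∘ (c ▷ (g · f)).
Proof. exact: iso_square (assoc_rwhisk c g f). Qed.

Lemma inv_lunit_assoc (X Y Z : K) (g : hom Y Z) (f : hom X Y) :
  assoc (id1 Z) g f ∘ ((lunit g)^-1 ▷ f) = (lunit (g · f))^-1.
Proof.
apply: (iso_monic (i := lunit (g · f))); rewrite (ra (lunit_assoc g f)) iso_mor_inv.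
by rewrite -rwhisk_comp iso_mor_inv rwhisk_id.
Qed.

Lemma inv_triangle (X Y Z : K) (g : hom Y Z) (f : hom X Y) :
  assoc g (id1 Y) f ∘ ((runit g)^-1 ▷ f) = g ◁ (lunit f)^-1.
Proof.
apply: (iso_monic (i := iso_lwhisk g (lunit f))) => /=; rewrite (ra (triangle g f)).
by rewrite -rwhisk_comp -lwhisk_comp !iso_mor_inv rwhisk_id lwhisk_id.
Qed.

Lemma pentagon' V X Y Z W (k : hom Z W) (h : hom Y Z) (g : hom X Y) (f : @hom K V X) :
  assoc k h (g · f) ∘ assoc (k · h) g f ∘ ((assoc k h g)^-1 ▷ f)
  = (k ◁ assoc h g f) ∘ assoc k (h · g) f.
Proof.
apply: (iso_epic (i := iso_rwhisk (assoc k h g) f)) => /=.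
by rewrite !compmA -rwhisk_comp iso_inv_mor rwhisk_id compm1 -pentagon.
Qed.

Lemma inv_pentagon V X Y Z W (k : hom Z W) (h : hom Y Z) (g : hom X Y) (f : @hom K V X) :
  assoc (k · h) g f ∘ ((assoc k h g)^-1 ▷ f)
  = (assoc k h (g · f))^-1 ∘ (k ◁ assoc h g f) ∘ assoc k (h · g) f.
Proof.
apply: (iso_monic (i := assoc k h (g · f))).
by rewrite pentagon' (ra (iso_mor_inv _)) comp1m.
Qed.

Lemma inv_pentagon_inv V X Y Z W
    (k : hom Z W) (h : hom Y Z) (g : hom X Y) (f : @hom K V X) :
  (assoc k h g ▷ f) ∘ (assoc (k · h) g f)^-1 ∘ (assoc k h (g · f))^-1
  = (assoc k (h · g) f)^-1 ∘ (k ◁ (assoc h g f)^-1).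
Proof.
apply: (iso_epic (i := assoc k h (g · f))); apply: (iso_epic (i := assoc (k · h) g f)).
rewrite !compmA (ra (iso_inv_mor _)) comp1m iso_inv_mor compm1 -pentagon.
rewrite (ra (esym (lwhisk_comp _ _ _))) iso_inv_mor lwhisk_id comp1m.
by rewrite (ra (iso_inv_mor _)) comp1m.
Qed.

Lemma lunit_assoc_inv (X Y Z : K) (g : hom Y Z) (f : hom X Y) :
  (lunit g ▷ f) ∘ (assoc (id1 Z) g f)^-1 = lunit (g · f).
Proof. by rewrite -lunit_assoc compmA iso_mor_inv compm1. Qed.

Lemma triangle_inv (X Y Z : K) (g : hom Y Z) (f : hom X Y) :
  (runit g ▷ f) ∘ (assoc g (id1 Y) f)^-1 = g ◁ lunit f.
Proof. by rewrite -triangle compmA iso_mor_inv compm1. Qed.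

Lemma pentagon_inv V X Y Z W (k : hom Z W) (h : hom Y Z) (g : hom X Y) (f : @hom K V X) :
  (assoc k h g ▷ f) ∘ (assoc (k · h) g f)^-1
  = (assoc k (h · g) f)^-1 ∘ (k ◁ (assoc h g f)^-1) ∘ assoc k h (g · f).
Proof.
apply: (iso_epic (i := iso_sym (assoc k h (g · f)))) => /=.
by rewrite !compmA iso_mor_inv compm1 inv_pentagon_inv.
Qed.

End InverseLemmas.

Section Lax.

Variables (D E : Bicategory) (J : Pseudofunctor D E) (T : RelPseudomonad J).

Lemma laxtr_eq (A B : Pseudoalgebra T) (h h' : LaxMorphism A B) (u v : LaxTransformation h h') :
  u = v :> (_ ⇒ _) -> u = v.
Proof.
case: u v => [u pu] [v pv] /= e; case: v / e pv => pv.
by rewrite (proof_irrelevance _ pu pv).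
Qed.

Definition lax_id_cell (A : Pseudoalgebra T) X (f : hom (J X) A) :
    aext A (id1 A · f) ⇒ id1 A · aext A f :=
  (lunit (aext A f))^-1 ∘ fmor (aext A) (lunit f).

Definition lax_id_structure (A : Pseudoalgebra T) : LaxStructure (id1 A : hom A A).
Proof.
exists (@lax_id_cell A); rewrite /lax_id_cell.
- move=> X f f' a.
  by rewrite (ra (inv_lunit_nat _)) !compmA -!fmor_comp lunit_nat.
- move=> X Y g f.
  rewrite [in RHS]rwhisk_comp [in RHS]compmA (ra (inv_lunit_assoc _ _)) !compmA.
  rewrite (ra (inv_lunit_nat _)) !compmA -ahat_natl -!fmor_comp (ra (lunit_assoc _ _)).
  by rewrite -rwhisk_comp -!compmA iso_mor_inv comp1m.
- move=> X f.
  rewrite rwhisk_comp !compmA (ra (inv_lunit_assoc _ _)) -atilde_nat.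
  by rewrite -compmA -inv_lunit_nat compmA iso_inv_mor compm1.
Defined.

Definition lax_id (A : Pseudoalgebra T) : LaxMorphism A A :=
  MkLaxMorphism (lax_id_structure A).

Definition lax_comp_cell (A B C : Pseudoalgebra T) (h' : LaxMorphism B C) (h : LaxMorphism A B)
    X (f : hom (J X) A) : aext C ((h' · h) · f) ⇒ (h' · h) · aext A f :=
  (assoc h' h (aext A f))^-1 ∘ (h' ◁ lax_str h X f) ∘ lax_str h' X (h · f)
  ∘ fmor (aext C) (assoc h' h f).

Definition lax_comp_structure (A B C : Pseudoalgebra T)
    (h' : LaxMorphism B C) (h : LaxMorphism A B) : LaxStructure (h' · h).
Proof.
exists (lax_comp_cell h' h); rewrite /lax_comp_cell.
- move=> X f f' a.
  rewrite !compmA -fmor_comp assoc_lwhisk fmor_comp (ra (lax_nat _ _)) !compmA.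
  by rewrite (ra (inv_assoc_lwhisk _ _ _)) !compmA !(ra (esym (lwhisk_comp _ _ _))) lax_nat.
- move=> X Y g f.
  rewrite !compmA (ra (inv_assoc_lwhisk _ _ _)) !rwhisk_comp !fmor_comp !compmA.
  rewrite (ra (inv_pentagon _ _ _ _)) !compmA.
  rewrite -ahat_natl (ra (esym (fmor_comp _ _ _))) (ra (esym (fmor_comp _ _ _))) compmA pentagon'.
  rewrite !fmor_comp !compmA (ra (lax_nat _ _)) !compmA.
  rewrite (ra (esym (fmor_comp _ _ _))) assoc_mwhisk fmor_comp !compmA (ra (lax_nat _ _)) !compmA.
  rewrite (ra (assoc_mwhisk _ _ _)) !compmA (ra3 (esym (lax_hat _ _ _))) !compmA.
  by rewrite !(ra (esym (lwhisk_comp _ _ _))) !compmA lax_hat.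
- move=> X f.
  rewrite !rwhisk_comp !compmA -atilde_nat (ra (inv_pentagon _ _ _ _)) !compmA.
  rewrite (ra (assoc_mwhisk _ _ _)) !compmA (ra3 (lax_tilde _ _)).
  rewrite !(ra (esym (lwhisk_comp _ _ _))) !compmA lax_tilde -compmA.
  by rewrite -inv_assoc_lwhisk compmA iso_inv_mor compm1.
Defined.

Definition lax_comp (A B C : Pseudoalgebra T) (h' : LaxMorphism B C) (h : LaxMorphism A B) :
    LaxMorphism A C :=
  MkLaxMorphism (lax_comp_structure h' h).

Definition laxtr_id (A B : Pseudoalgebra T) (h : LaxMorphism A B) : LaxTransformation h h.
Proof.
exists (idm (lax_1cell h)) => X f.
by rewrite !rwhisk_id fmor_id compm1 comp1m.
Defined.

Definition laxtr_comp (A B : Pseudoalgebra T) (h h' h'' : LaxMorphism A B)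
    (v : LaxTransformation h' h'') (u : LaxTransformation h h') : LaxTransformation h h''.
Proof.
exists (v ∘ u) => X f.
by rewrite !rwhisk_comp fmor_comp (ra (laxtr_law _ _)) !compmA laxtr_law.
Defined.

Definition LaxHom (A B : Pseudoalgebra T) : Category.
Proof.
refine {| cob := LaxMorphism A B;
          mor := @LaxTransformation _ _ _ _ A B;
          idm := @laxtr_id A B;
          compm := @laxtr_comp A B |}.
- by move=> h h' u; apply: laxtr_eq; apply: compm1.
- by move=> h h' u; apply: laxtr_eq; apply: comp1m.
- by move=> h1 h2 h3 h4 u v w; apply: laxtr_eq; apply: compmA.
Defined.

Definition laxtr_lwhisk (A B C : Pseudoalgebra T) (k : LaxMorphism B C) (h h' : LaxMorphism A B)
    (a : LaxTransformation h h') : LaxTransformation (lax_comp k h) (lax_comp k h').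
Proof.
exists (k ◁ a) => X f /=; rewrite /lax_comp_cell !compmA.
rewrite -fmor_comp assoc_mwhisk fmor_comp (ra (lax_nat _ _)) !compmA.
by rewrite (ra (inv_assoc_mwhisk _ _ _)) compmA !(ra (esym (lwhisk_comp _ _ _))) laxtr_law.
Defined.

Definition laxtr_rwhisk (A B C : Pseudoalgebra T) (k k' : LaxMorphism B C)
    (b : LaxTransformation k k') (h : LaxMorphism A B) :
  LaxTransformation (lax_comp k h) (lax_comp k' h).
Proof.
exists (b ▷ h) => X f /=; rewrite /lax_comp_cell !compmA.
rewrite -fmor_comp assoc_rwhisk fmor_comp (ra (laxtr_law _ _)) !compmA.
by rewrite (ra (inv_assoc_rwhisk _ _ _)) compmA (ra (interchange _ _)) compmA.
Defined.

Section LaxTransformationIso.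

Variables (A B : Pseudoalgebra T) (h h' : LaxMorphism A B).
Variable i : lax_1cell h ≅ lax_1cell h'.
Hypothesis law : forall X (f : hom (J X) A),
  lax_str h' X f ∘ fmor (aext B) (i ▷ f) = (i ▷ aext A f) ∘ lax_str h X f.

Lemma laxtr_inv_law X (f : hom (J X) A) :
  lax_str h X f ∘ fmor (aext B) (i^-1 ▷ f) = (i^-1 ▷ aext A f) ∘ lax_str h' X f.
Proof.
have := iso_square (i := iso_fmor (aext B) (iso_rwhisk i f))
                   (i' := iso_rwhisk i (aext A f)) (esym (law f)).
by [].
Qed.

Definition laxtr_iso : @Iso (LaxHom A B) h h'.
Proof.
refine (@Build_Iso (LaxHom A B) h h' (Build_LaxTransformation law)
          (Build_LaxTransformation laxtr_inv_law) _ _); apply: laxtr_eq.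
- exact: iso_inv_mor.
- exact: iso_mor_inv.
Defined.

End LaxTransformationIso.

Definition laxtr_assoc (A B C D' : Pseudoalgebra T)
    (h : LaxMorphism C D') (g : LaxMorphism B C) (f : LaxMorphism A B) :
  @Iso (LaxHom A D') (lax_comp (lax_comp h g) f) (lax_comp h (lax_comp g f)).
Proof.
apply: (@laxtr_iso _ _ (lax_comp (lax_comp h g) f) (lax_comp h (lax_comp g f)) (assoc h g f)).
move=> X k /=; rewrite /lax_comp_cell /= /lax_comp_cell !lwhisk_comp !compmA.
rewrite -!fmor_comp !(ra (inv_assoc_lwhisk _ _ _)) !compmA -pentagon !fmor_comp.
by rewrite (ra (lax_nat _ _)) !compmA (ra3 (inv_pentagon_inv _ _ _ _)) !compmA.
Defined.

Definition laxtr_lunit (A B : Pseudoalgebra T) (f : LaxMorphism A B) :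
  @Iso (LaxHom A B) (lax_comp (lax_id B) f) f.
Proof.
apply: (@laxtr_iso _ _ (lax_comp (lax_id B) f) f (lunit f)).
move=> X k /=; rewrite /lax_comp_cell /= /lax_id_cell !compmA.
rewrite -fmor_comp lunit_assoc (ra (lunit_assoc_inv _ _)) (ra (lunit_nat _)) compmA.
by rewrite (ra (iso_mor_inv _)) comp1m.
Defined.

Definition laxtr_runit (A B : Pseudoalgebra T) (f : LaxMorphism A B) :
  @Iso (LaxHom A B) (lax_comp f (lax_id A)) f.
Proof.
apply: (@laxtr_iso _ _ (lax_comp f (lax_id A)) f (runit f)).
move=> X k /=; rewrite /lax_comp_cell /= /lax_id_cell lwhisk_comp !compmA.
rewrite (ra (triangle_inv _ _)) (ra (esym (lwhisk_comp _ _ _))) iso_mor_inv lwhisk_id comp1m.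
by rewrite (ra (esym (lax_nat _ _))) compmA -fmor_comp triangle.
Defined.

Definition PsAlg_l : Bicategory.
Proof.
refine {| ob := Pseudoalgebra T;
          hom := LaxHom;
          id1 := lax_id;
          comp1 := lax_comp;
          lwhisk := laxtr_lwhisk;
          rwhisk := laxtr_rwhisk;
          assoc := laxtr_assoc;
          lunit := laxtr_lunit;
          runit := laxtr_runit |}; intros; apply: laxtr_eq => /=.
- exact: lwhisk_id.
- exact: lwhisk_comp.
- exact: rwhisk_id.
- exact: rwhisk_comp.
- exact: interchange.
- exact: assoc_lwhisk.
- exact: assoc_mwhisk.
- exact: assoc_rwhisk.
- exact: lunit_nat.
- exact: runit_nat.
- exact: pentagon.
- exact: triangle.
Defined.

End Lax.

Section Colax.

Variables (D E : Bicategory) (J : Pseudofunctor D E) (T : RelPseudomonad J).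

Lemma colaxtr_eq (A B : Pseudoalgebra T) (h h' : ColaxMorphism A B) (u v : ColaxTransformation h h') :
  u = v :> (_ ⇒ _) -> u = v.
Proof.
case: u v => [u pu] [v pv] /= e; case: v / e pv => pv.
by rewrite (proof_irrelevance _ pu pv).
Qed.

Definition colax_id_cell (A : Pseudoalgebra T) X (f : hom (J X) A) :
    id1 A · aext A f ⇒ aext A (id1 A · f) :=
  fmor (aext A) (lunit f)^-1 ∘ lunit (aext A f).

Definition colax_id_structure (A : Pseudoalgebra T) : ColaxStructure (id1 A : hom A A).
Proof.
exists (@colax_id_cell A); rewrite /colax_id_cell.
- move=> X f f' a.
  by rewrite compmA lunit_nat -!compmA -!fmor_comp inv_lunit_nat.
- move=> X Y g f.
  rewrite !rwhisk_comp !fmor_comp !compmA (ra (lunit_assoc_inv _ _)) lunit_nat.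
  rewrite (ra (esym (ahat_natl _ _))) !(ra (esym (fmor_comp _ _ _))) !compmA.
  by rewrite (ra (lunit_assoc_inv _ _)) iso_mor_inv compm1.
- move=> X f.
  rewrite rwhisk_comp !compmA (ra (lunit_assoc_inv _ _)) lunit_nat.
  by rewrite (ra (esym (atilde_nat _))) compmA iso_inv_mor compm1.
Defined.

Definition colax_id (A : Pseudoalgebra T) : ColaxMorphism A A :=
  MkColaxMorphism (colax_id_structure A).

Definition colax_comp_cell (A B C : Pseudoalgebra T)
    (h' : ColaxMorphism B C) (h : ColaxMorphism A B) X (f : hom (J X) A) :
    (h' · h) · aext A f ⇒ aext C ((h' · h) · f) :=
  fmor (aext C) (assoc h' h f)^-1 ∘ colax_str h' X (h · f) ∘ (h' ◁ colax_str h X f)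
  ∘ assoc h' h (aext A f).

Definition colax_comp_structure (A B C : Pseudoalgebra T)
    (h' : ColaxMorphism B C) (h : ColaxMorphism A B) : ColaxStructure (h' · h).
Proof.
exists (colax_comp_cell h' h); rewrite /colax_comp_cell.
- move=> X f f' a.
  rewrite !compmA assoc_lwhisk !(ra (esym (lwhisk_comp _ _ _))) colax_nat lwhisk_comp.
  rewrite !compmA (ra (colax_nat _ _)) !compmA !(ra (esym (fmor_comp _ _ _))).
  by rewrite inv_assoc_lwhisk.
- move=> X Y g f.
  rewrite !rwhisk_comp !fmor_comp !compmA (ra (pentagon_inv _ _ _ _)) !compmA assoc_lwhisk.
  rewrite (ra (inv_assoc_mwhisk _ _ _)) !compmA.
  rewrite !(ra (esym (lwhisk_comp _ _ _))) !compmA -colax_hat !lwhisk_comp !compmA.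
  rewrite (ra3 (esym (colax_hat _ _ _))) !compmA (ra (esym (ahat_natl _ _))) !compmA.
  do 2!rewrite (ra (colax_nat _ _)) !compmA.
  rewrite !(ra (esym (fmor_comp _ _ _))) !compmA inv_pentagon_inv.
  by rewrite (ra (inv_assoc_mwhisk _ _ _)) compmA.
- move=> X f.
  rewrite !rwhisk_comp !compmA (ra (pentagon_inv _ _ _ _)) !compmA assoc_lwhisk.
  rewrite (ra (inv_assoc_mwhisk _ _ _)) !compmA !(ra (esym (lwhisk_comp _ _ _))) !compmA.
  rewrite colax_tilde (ra3 (colax_tilde _ _)) (ra (esym (atilde_nat _))) compmA.
  by rewrite iso_inv_mor compm1.
Defined.

Definition colax_comp (A B C : Pseudoalgebra T) (h' : ColaxMorphism B C) (h : ColaxMorphism A B) :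
    ColaxMorphism A C :=
  MkColaxMorphism (colax_comp_structure h' h).

Definition colaxtr_id (A B : Pseudoalgebra T) (h : ColaxMorphism A B) : ColaxTransformation h h.
Proof.
exists (idm (colax_1cell h)) => X f.
by rewrite !rwhisk_id fmor_id compm1 comp1m.
Defined.

Definition colaxtr_comp (A B : Pseudoalgebra T) (h h' h'' : ColaxMorphism A B)
    (v : ColaxTransformation h' h'') (u : ColaxTransformation h h') : ColaxTransformation h h''.
Proof.
exists (v ∘ u) => X f.
by rewrite !rwhisk_comp fmor_comp !compmA colaxtr_law (ra (colaxtr_law _ _)) !compmA.
Defined.

Definition ColaxHom (A B : Pseudoalgebra T) : Category.
Proof.
refine {| cob := ColaxMorphism A B;
          mor := @ColaxTransformation _ _ _ _ A B;
          idm := @colaxtr_id A B;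
          compm := @colaxtr_comp A B |}.
- by move=> h h' u; apply: colaxtr_eq; apply: compm1.
- by move=> h h' u; apply: colaxtr_eq; apply: comp1m.
- by move=> h1 h2 h3 h4 u v w; apply: colaxtr_eq; apply: compmA.
Defined.

Definition colaxtr_lwhisk (A B C : Pseudoalgebra T) (k : ColaxMorphism B C) (h h' : ColaxMorphism A B)
    (a : ColaxTransformation h h') : ColaxTransformation (colax_comp k h) (colax_comp k h').
Proof.
exists (k ◁ a) => X f /=; rewrite /colax_comp_cell !compmA.
rewrite (ra (esym (fmor_comp _ _ _))) inv_assoc_mwhisk fmor_comp !compmA.
rewrite (ra (esym (colax_nat _ _))) !compmA (ra (esym (lwhisk_comp _ _ _))) colaxtr_law.
by rewrite lwhisk_comp !compmA -assoc_mwhisk.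
Defined.

Definition colaxtr_rwhisk (A B C : Pseudoalgebra T) (k k' : ColaxMorphism B C)
    (b : ColaxTransformation k k') (h : ColaxMorphism A B) :
  ColaxTransformation (colax_comp k h) (colax_comp k' h).
Proof.
exists (b ▷ h) => X f /=; rewrite /colax_comp_cell !compmA.
rewrite (ra (esym (fmor_comp _ _ _))) inv_assoc_rwhisk fmor_comp !compmA.
by rewrite (ra (colaxtr_law _ _)) compmA (ra (interchange _ _)) compmA assoc_rwhisk.
Defined.

Section ColaxTransformationIso.

Variables (A B : Pseudoalgebra T) (h h' : ColaxMorphism A B).
Variable i : colax_1cell h ≅ colax_1cell h'.
Hypothesis law : forall X (f : hom (J X) A),
  fmor (aext B) (i ▷ f) ∘ colax_str h X f = colax_str h' X f ∘ (i ▷ aext A f).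

Lemma colaxtr_inv_law X (f : hom (J X) A) :
  fmor (aext B) (i^-1 ▷ f) ∘ colax_str h' X f = colax_str h X f ∘ (i^-1 ▷ aext A f).
Proof.
symmetry.
exact: (iso_square (i := iso_rwhisk i (aext A f)) (i' := iso_fmor (aext B) (iso_rwhisk i f)) (law f)).
Qed.

Definition colaxtr_iso : @Iso (ColaxHom A B) h h'.
Proof.
refine (@Build_Iso (ColaxHom A B) h h' (Build_ColaxTransformation law)
          (Build_ColaxTransformation colaxtr_inv_law) _ _); apply: colaxtr_eq.
- exact: iso_inv_mor.
- exact: iso_mor_inv.
Defined.

End ColaxTransformationIso.

Definition colaxtr_assoc (A B C D' : Pseudoalgebra T)
    (h : ColaxMorphism C D') (g : ColaxMorphism B C) (f : ColaxMorphism A B) :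
  @Iso (ColaxHom A D') (colax_comp (colax_comp h g) f) (colax_comp h (colax_comp g f)).
Proof.
apply: (@colaxtr_iso _ _ (colax_comp (colax_comp h g) f) (colax_comp h (colax_comp g f))
          (assoc h g f)).
move=> X k /=; rewrite /colax_comp_cell /= /colax_comp_cell !lwhisk_comp !compmA.
rewrite !(ra (esym (fmor_comp _ _ _))) !compmA inv_pentagon_inv fmor_comp !compmA.
by rewrite (ra (esym (colax_nat _ _))) !compmA (ra (assoc_lwhisk _ _ _)) !compmA pentagon.
Defined.

Definition colaxtr_lunit (A B : Pseudoalgebra T) (f : ColaxMorphism A B) :
  @Iso (ColaxHom A B) (colax_comp (colax_id B) f) f.
Proof.
apply: (@colaxtr_iso _ _ (colax_comp (colax_id B) f) f (lunit f)).
move=> X k /=; rewrite /colax_comp_cell /= /colax_id_cell !compmA.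
rewrite (ra (lunit_nat _)) compmA lunit_assoc !(ra (esym (fmor_comp _ _ _))) !compmA.
by rewrite (ra (lunit_assoc_inv _ _)) iso_mor_inv fmor_id comp1m.
Defined.

Definition colaxtr_runit (A B : Pseudoalgebra T) (f : ColaxMorphism A B) :
  @Iso (ColaxHom A B) (colax_comp f (colax_id A)) f.
Proof.
apply: (@colaxtr_iso _ _ (colax_comp f (colax_id A)) f (runit f)).
move=> X k /=; rewrite /colax_comp_cell /= /colax_id_cell lwhisk_comp !compmA.
rewrite triangle (ra (esym (fmor_comp _ _ _))) triangle_inv (ra (esym (colax_nat _ _))) compmA.
rewrite (ra (esym (lwhisk_comp _ _ _))) -fmor_comp iso_mor_inv fmor_id lwhisk_id.
by rewrite comp1m.
Defined.

Definition PsAlg_c : Bicategory.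
Proof.
refine {| ob := Pseudoalgebra T;
          hom := ColaxHom;
          id1 := colax_id;
          comp1 := colax_comp;
          lwhisk := colaxtr_lwhisk;
          rwhisk := colaxtr_rwhisk;
          assoc := colaxtr_assoc;
          lunit := colaxtr_lunit;
          runit := colaxtr_runit |}; intros; apply: colaxtr_eq => /=.
- exact: lwhisk_id.
- exact: lwhisk_comp.
- exact: rwhisk_id.
- exact: rwhisk_comp.
- exact: interchange.
- exact: assoc_lwhisk.
- exact: assoc_mwhisk.
- exact: assoc_rwhisk.
- exact: lunit_nat.
- exact: runit_nat.
- exact: pentagon.
- exact: triangle.
Defined.

End Colax.

Section Lifting.

Variables (D E : Bicategory) (J : Pseudofunctor D E) (T : RelPseudomonad J).
Variables (A B : Pseudoalgebra T) (l : hom A B) (r : hom B A) (adj : Adjunction l r).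

Definition lax_mate (lbar : ColaxStructure l) X (g : hom (J X) B) :
    aext A (r · g) ⇒ r · aext B g :=
  (r ◁ fmor (aext B) (lunit g ∘ (counit adj ▷ g) ∘ (assoc l r g)^-1))
  ∘ (r ◁ lbar X (r · g))
  ∘ assoc r l (aext A (r · g)) ∘ (unit adj ▷ aext A (r · g)) ∘ (lunit (aext A (r · g)))^-1.

Definition colax_mate (rbar : LaxStructure r) X (f : hom (J X) A) :
    l · aext A f ⇒ aext B (l · f) :=
  lunit (aext B (l · f)) ∘ (counit adj ▷ aext B (l · f)) ∘ (assoc l r (aext B (l · f)))^-1
  ∘ (l ◁ rbar X (l · f))
  ∘ (l ◁ fmor (aext A) (assoc r l f ∘ (unit adj ▷ f) ∘ (lunit f)^-1)).

Definition mates (lbar : ColaxStructure l) (rbar : LaxStructure r) : Prop :=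
  (forall X (f : hom (J X) A), lbar X f = colax_mate rbar f) /\
  (forall X (g : hom (J X) B), rbar X g = lax_mate lbar g).

(* The lax structure s on l makes (l, s) -| (r, rbar) an adjunction in PsAlg_l T
   lying over l -| r, with the same unit and counit. *)
Definition is_lax_lift (rbar : LaxStructure r) (s : LaxStructure l) : Prop :=
  exists adj' : @Adjunction (PsAlg_l T) A B (MkLaxMorphism s) (MkLaxMorphism rbar),
    laxtr_cell (unit adj') = unit adj /\ laxtr_cell (counit adj') = counit adj.

Definition is_colax_lift (lbar : ColaxStructure l) (s : ColaxStructure r) : Prop :=
  exists adj' : @Adjunction (PsAlg_c T) A B (MkColaxMorphism lbar) (MkColaxMorphism s),
    colaxtr_cell (unit adj') = unit adj /\ colaxtr_cell (counit adj') = counit adj.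

Definition lifts_to_PsAlg_l (rbar : LaxStructure r) : Prop :=
  exists s : LaxStructure l, is_lax_lift rbar s.

Definition lifts_to_PsAlg_c (lbar : ColaxStructure l) : Prop :=
  exists s : ColaxStructure r, is_colax_lift lbar s.

End Lifting.

(* Main.v *)
Require Import Defs.
From Stdlib Require Import ssreflect ClassicalEpsilon.
Local Open Scope bicat_scope.

Set Implicit Arguments.
Unset Strict Implicit.
Unset Printing Implicit Defensive.

(** Postcomposition with an adjunction [l ⊣ r] gives an adjunction
    [l · - ⊣ r · -] between hom-categories, and mates are transposes across it.
    Writing [ν], [ε] for the unit and counit of this adjunction and [(-)^a],
    [(-)^b] for the extension functors of [A] and [B], the two mate equations
    therefore say
      [(r ◁ lbar f) ∘ ν = rbar (l · f) ∘ (ν f)^a]   ([mates_unit]),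
      [ε ∘ (l ◁ rbar g) = (ε g)^b ∘ lbar (r · g)]   ([mates_counit]).

    On the other side, once the coherence isomorphisms are cancelled, the
    condition that the unit be a transformation for a lax structure [s] on [l]
    reads [(r ◁ s f) ∘ rbar (l · f) ∘ (ν f)^a = ν].  By [mates_unit] the left
    side is the transpose of [s f ∘ lbar f], and the right side is the transpose
    of the identity, so the condition says [s f ∘ lbar f = id].  Similarly,
    [mates_counit] turns the condition on the counit into
    [(ε g)^b ∘ lbar (r · g) ∘ s (r · g) = (ε g)^b], which by naturality of [s] and a
    triangle identity amounts to [lbar f ∘ s f = id] for all [f].  Hence [s] is a
    lift exactly when it is a pointwise inverse of [lbar] ([is_lax_lift_iff]).

    It remains to see that pointwise inverses of a colax structure always satisfy
    the axioms of a lax structure ([inverse_lax_structure]); this is because every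
    axiom of one kind is an axiom of the other kind with the structure cells moved
    across the equation.  The colax half of the theorem is dual. *)

(** * The adjunction between hom-categories *)

Section Postcomposition.

Variables (K : Bicategory) (A B : K) (l : hom A B) (r : hom B A).
Variable adj : Adjunction l r.

Definition post_unit (X : K) (f : hom X A) : f ⇒ r · (l · f) :=
  assoc r l f ∘ (unit adj ▷ f) ∘ (lunit f)^-1.

Definition post_counit (X : K) (g : hom X B) : l · (r · g) ⇒ g :=
  lunit g ∘ (counit adj ▷ g) ∘ (assoc l r g)^-1.

Lemma post_unit_nat (X : K) (f f' : hom X A) (u : f ⇒ f') :
  (r ◁ (l ◁ u)) ∘ post_unit f = post_unit f' ∘ u.
Proof.
rewrite /post_unit !compmA -inv_lunit_nat (ra (interchange _ _)).
by rewrite (ra (eq_sym (assoc_lwhisk _ _ _))) !compmA.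
Qed.

Lemma post_counit_nat (X : K) (g g' : hom X B) (v : g ⇒ g') :
  post_counit g' ∘ (l ◁ (r ◁ v)) = v ∘ post_counit g.
Proof.
rewrite /post_counit !compmA -inv_assoc_lwhisk (ra (interchange _ _)) !compmA.
by rewrite (ra (lunit_nat _)) !compmA.
Qed.

(** The left triangle identity of [l ⊣ r] whiskered with [f]; the pentagon and the
    triangle axioms move the coherence cells into place. *)
Lemma post_triangle_l (X : K) (f : hom X A) :
  post_counit (l · f) ∘ (l ◁ post_unit f) = idm (l · f).
Proof.
rewrite /post_counit /post_unit !lwhisk_comp !compmA -inv_triangle.
rewrite (ra (eq_sym (assoc_mwhisk _ _ _))) !compmA (ra3 (eq_sym (inv_pentagon _ _ _ _))) !compmA.
rewrite (ra (eq_sym (assoc_rwhisk _ _ _))) !compmA (ra (lunit_assoc _ _)).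
by rewrite -!rwhisk_comp adj_triangle_l rwhisk_id.
Qed.

Lemma post_triangle_r (X : K) (g : hom X B) :
  (r ◁ post_counit g) ∘ post_unit (r · g) = idm (r · g).
Proof.
rewrite /post_counit /post_unit !lwhisk_comp !compmA -inv_lunit_assoc.
rewrite (ra (eq_sym (assoc_rwhisk _ _ _))) !compmA (ra (eq_sym (pentagon _ _ _ _))) !compmA.
rewrite (ra (eq_sym (lwhisk_comp r (assoc l r g)^-1 _))) iso_inv_mor lwhisk_id comp1m.
rewrite (ra (eq_sym (assoc_mwhisk _ _ _))) !compmA (ra (triangle _ _)).
by rewrite -!rwhisk_comp adj_triangle_r rwhisk_id.
Qed.

Lemma post_transpose (X : K) (f : hom X A) (g : hom X B)
    (v : l · f ⇒ g) (u : f ⇒ r · g) :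
  v = post_counit g ∘ (l ◁ u) <-> (r ◁ v) ∘ post_unit f = u.
Proof.
split=> [-> | <-].
- by rewrite lwhisk_comp compmA post_unit_nat (ra (post_triangle_r _)) comp1m.
- by rewrite lwhisk_comp (ra (post_counit_nat _)) compmA post_triangle_l compm1.
Qed.

Lemma post_unit_cancel (X : K) (f : hom X A) (v : l · f ⇒ l · f) :
  (r ◁ v) ∘ post_unit f = post_unit f <-> v = idm (l · f).
Proof.
split=> [/post_transpose -> | ->]; first exact: post_triangle_l.
by rewrite lwhisk_id comp1m.
Qed.

Lemma post_counit_cancel (X : K) (g : hom X B) (u : r · g ⇒ r · g) :
  post_counit g ∘ (l ◁ u) = post_counit g <-> u = idm (r · g).
Proof.
split=> [e | ->]; last by rewrite lwhisk_id compm1.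
by rewrite -(proj1 (post_transpose _ _) (eq_sym e)) post_triangle_r.
Qed.

End Postcomposition.

(** * Pointwise inverses of lax and colax structures *)

Definition iso_comp (C : Category) (x y z : C) (j : y ≅ z) (i : x ≅ y) : x ≅ z.
Proof.
refine (@Build_Iso _ _ _ (j ∘ i) (i^-1 ∘ j^-1) _ _).
- by rewrite compmA (ra (iso_inv_mor j)) comp1m iso_inv_mor.
- by rewrite compmA (ra (iso_mor_inv i)) comp1m iso_mor_inv.
Defined.

Definition iso_of_inverse (C : Category) (x y : C) (u : x ⇒ y) (v : y ⇒ x)
    (uv : inverse_of u v) : x ≅ y :=
  Build_Iso (proj1 uv) (proj2 uv).

Section InverseStructures.

Variables (D E : Bicategory) (J : Pseudofunctor D E) (T : RelPseudomonad J).
Variables (A B : Pseudoalgebra T) (h : hom A B).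

(** In each axiom the structure cells are invertible, so the axiom is a commuting
    square with two invertible sides; inverting these sides gives the axiom of the
    opposite variance. *)
Lemma inverse_lax_structure (t : ColaxStructure h)
    (u : forall X (f : hom (J X) A), aext B (h · f) ⇒ h · aext A f)
    (tu : forall X (f : hom (J X) A), inverse_of (t X f) (u X f)) :
  exists s : LaxStructure h, forall X (f : hom (J X) A), s X f = u X f.
Proof.
unshelve eexists; first exists u; last by [].
- move=> X f f' a.
  exact: eq_sym (iso_square (i := iso_of_inverse (tu X f)) (i' := iso_of_inverse (tu X f'))
                 (colax_nat t a)).
- move=> X Y g f.
  pose tg := iso_of_inverse (tu Y g).
  pose i := iso_comp (iso_fmor (aext B) (iso_rwhisk tg f))
              (iso_comp (iso_fmor (aext B) (iso_sym (assoc h (aext A g) f)))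
                 (iso_of_inverse (tu X (aext A g · f)))).
  pose i' := iso_comp (iso_rwhisk tg (ext T f)) (iso_sym (assoc h (aext A g) (ext T f))).
  have := iso_square (i := i) (i' := i') (a := h ◁ ahat A g f) (b := ahat B (h · g) f).
  rewrite /= !compmA; apply.
  by rewrite -colax_hat.
- move=> X f.
  apply: (iso_monic (i := iso_comp (iso_rwhisk (iso_of_inverse (tu X f)) (tunit T X))
                            (iso_sym (assoc h (aext A f) (tunit T X))))).
  rewrite /= !compmA colax_tilde (ra (iso_inv_mor _)) comp1m.
  by rewrite (ra (eq_sym (rwhisk_comp _ _ _))) (proj2 (tu X f)) rwhisk_id comp1m.
Qed.

Lemma inverse_colax_structure (t : LaxStructure h)
    (u : forall X (f : hom (J X) A), h · aext A f ⇒ aext B (h · f))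
    (tu : forall X (f : hom (J X) A), inverse_of (t X f) (u X f)) :
  exists s : ColaxStructure h, forall X (f : hom (J X) A), s X f = u X f.
Proof.
unshelve eexists; first exists u; last by [].
- move=> X f f' a.
  exact: eq_sym (iso_square (i := iso_of_inverse (tu X f)) (i' := iso_of_inverse (tu X f'))
                 (lax_nat t a)).
- move=> X Y g f.
  pose tg := iso_of_inverse (tu Y g).
  pose i := iso_comp (iso_of_inverse (tu X (aext A g · f)))
              (iso_comp (iso_fmor (aext B) (assoc h (aext A g) f))
                 (iso_fmor (aext B) (iso_rwhisk tg f))).
  pose i' := iso_comp (assoc h (aext A g) (ext T f)) (iso_rwhisk tg (ext T f)).
  have := iso_square (i := i) (i' := i') (a := ahat B (h · g) f) (b := h ◁ ahat A g f).
  rewrite /= !compmA; apply.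
  by rewrite lax_hat.
- move=> X f.
  apply: (iso_monic (i := iso_comp (assoc h (aext A f) (tunit T X))
                            (iso_rwhisk (iso_of_inverse (tu X f)) (tunit T X)))).
  rewrite /= !compmA lax_tilde (ra (eq_sym (rwhisk_comp _ _ _))) (proj2 (tu X f)).
  by rewrite rwhisk_id comp1m (ra (iso_mor_inv _)) comp1m.
Qed.

(** Pointwise invertibility only asserts that inverses exist; the axiom of choice
    collects them into a family. *)
Lemma colax_is_pseudo_iff (t : ColaxStructure h) :
  colax_is_pseudo t <->
  exists s : LaxStructure h, forall X (f : hom (J X) A), inverse_of (s X f) (t X f).
Proof.
split=> [inv | [s st] X f]; last by exists (s X f); split; case: (st X f).
pose w X f := constructive_indefinite_description _ (inv X f).
have [s su] := inverse_lax_structure (fun X f => proj2_sig (w X f)).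
by exists s => X f; rewrite su; case: (proj2_sig (w X f)).
Qed.

Lemma lax_is_pseudo_iff (t : LaxStructure h) :
  lax_is_pseudo t <->
  exists s : ColaxStructure h, forall X (f : hom (J X) A), inverse_of (s X f) (t X f).
Proof.
split=> [inv | [s st] X f]; last by exists (s X f); split; case: (st X f).
pose w X f := constructive_indefinite_description _ (inv X f).
have [s su] := inverse_colax_structure (fun X f => proj2_sig (w X f)).
by exists s => X f; rewrite su; case: (proj2_sig (w X f)).
Qed.

End InverseStructures.

(** * Lifts as inverses of mates *)

Section Lifts.

Variables (D E : Bicategory) (J : Pseudofunctor D E) (T : RelPseudomonad J).
Variables (A B : Pseudoalgebra T) (l : hom A B) (r : hom B A).
Variable adj : Adjunction l r.

(** The triangle identities are equations of underlying 2-cells, so a lift only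
    requires the unit and the counit to be transformations; the equations below
    are these two conditions with the coherence cells absorbed into the unit and
    counit of postcomposition. *)
Lemma is_lax_liftP (rbar : LaxStructure r) (s : LaxStructure l) :
  is_lax_lift adj rbar s <->
  (forall X (f : hom (J X) A),
     (r ◁ s X f) ∘ rbar X (l · f) ∘ fmor (aext A) (post_unit adj f)
     = post_unit adj (aext A f)) /\
  (forall X (g : hom (J X) B),
     post_counit adj (aext B g) ∘ (l ◁ rbar X g) ∘ s X (r · g)
     = fmor (aext B) (post_counit adj g)).
Proof.
have unitP X (f : hom (J X) A) :
  lax_comp_cell (MkLaxMorphism rbar) (MkLaxMorphism s) f ∘ fmor (aext A) (unit adj ▷ f)
    = (unit adj ▷ aext A f) ∘ lax_id_cell f <->
  (r ◁ s X f) ∘ rbar X (l · f) ∘ fmor (aext A) (post_unit adj f)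
    = post_unit adj (aext A f).
{ rewrite /lax_comp_cell /lax_id_cell /post_unit /= !fmor_comp !compmA.
  split=> [e | e].
  - apply: (iso_epic (i := iso_fmor (aext A) (lunit f))).
    apply: (iso_monic (i := iso_sym (assoc r l (aext A f)))) => /=.
    rewrite !compmA -[fmor _ (lunit f)^-1 ∘ _]fmor_comp iso_inv_mor fmor_id compm1.
    by rewrite e (ra (iso_inv_mor _)) comp1m.
  - apply: (iso_monic (i := assoc r l (aext A f))).
    apply: (iso_epic (i := iso_fmor (aext A) (iso_sym (lunit f)))) => /=.
    rewrite !compmA (ra (iso_mor_inv _)) comp1m e -fmor_comp iso_mor_inv fmor_id.
    by rewrite compm1. }
have counitP X (g : hom (J X) B) :
  lax_id_cell g ∘ fmor (aext B) (counit adj ▷ g)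
    = (counit adj ▷ aext B g)
      ∘ lax_comp_cell (MkLaxMorphism s) (MkLaxMorphism rbar) g <->
  post_counit adj (aext B g) ∘ (l ◁ rbar X g) ∘ s X (r · g)
    = fmor (aext B) (post_counit adj g).
{ rewrite /lax_comp_cell /lax_id_cell /post_counit /= !fmor_comp !compmA.
  split=> [e | e].
  - apply: (iso_epic (i := iso_fmor (aext B) (assoc l r g))).
    apply: (iso_monic (i := iso_sym (lunit (aext B g)))) => /=.
    rewrite !compmA -[fmor _ (assoc l r g)^-1 ∘ _]fmor_comp iso_inv_mor fmor_id compm1.
    by rewrite e (ra (iso_inv_mor _)) comp1m.
  - apply: (iso_monic (i := lunit (aext B g))).
    apply: (iso_epic (i := iso_fmor (aext B) (iso_sym (assoc l r g)))) => /=.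
    rewrite !compmA (ra (iso_mor_inv _)) comp1m -[fmor _ (assoc l r g) ∘ _]fmor_comp.
    by rewrite iso_mor_inv fmor_id compm1 e. }
split=> [[adj' [eu ec]] | [U C]].
- split=> X f.
  + by apply/unitP; rewrite -eu; apply: (laxtr_law (unit adj')).
  + by apply/counitP; rewrite -ec; apply: (laxtr_law (counit adj')).
- pose nu := Build_LaxTransformation (h := lax_id A)
    (h' := lax_comp (MkLaxMorphism rbar) (MkLaxMorphism s)) (fun X f => proj2 (unitP X f) (U X f)).
  pose ep := Build_LaxTransformation (h' := lax_id B)
    (h := lax_comp (MkLaxMorphism s) (MkLaxMorphism rbar)) (fun X f => proj2 (counitP X f) (C X f)).
  unshelve eexists.
  + apply: (@Build_Adjunction (PsAlg_l T) A B (MkLaxMorphism s) (MkLaxMorphism rbar) nu ep).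
    * by apply: laxtr_eq; apply: adj_triangle_l.
    * by apply: laxtr_eq; apply: adj_triangle_r.
  + by [].
Qed.

Lemma is_colax_liftP (lbar : ColaxStructure l) (s : ColaxStructure r) :
  is_colax_lift adj lbar s <->
  (forall X (f : hom (J X) A),
     s X (l · f) ∘ (r ◁ lbar X f) ∘ post_unit adj (aext A f)
     = fmor (aext A) (post_unit adj f)) /\
  (forall X (g : hom (J X) B),
     fmor (aext B) (post_counit adj g) ∘ lbar X (r · g) ∘ (l ◁ s X g)
     = post_counit adj (aext B g)).
Proof.
have unitP X (f : hom (J X) A) :
  fmor (aext A) (unit adj ▷ f) ∘ colax_id_cell f
    = colax_comp_cell (MkColaxMorphism s) (MkColaxMorphism lbar) f
      ∘ (unit adj ▷ aext A f) <->
  s X (l · f) ∘ (r ◁ lbar X f) ∘ post_unit adj (aext A f)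
    = fmor (aext A) (post_unit adj f).
{ rewrite /colax_comp_cell /colax_id_cell /post_unit /= !fmor_comp !compmA.
  split=> [e | e].
  - apply: (iso_epic (i := lunit (aext A f))).
    apply: (iso_monic (i := iso_fmor (aext A) (iso_sym (assoc r l f)))) => /=.
    rewrite !compmA iso_inv_mor compm1 -e.
    by rewrite (ra (eq_sym (fmor_comp _ (assoc r l f)^-1 _))) iso_inv_mor fmor_id comp1m.
  - apply: (iso_monic (i := iso_fmor (aext A) (assoc r l f))).
    apply: (iso_epic (i := iso_sym (lunit (aext A f)))) => /=.
    rewrite !compmA iso_mor_inv compm1 -e.
    by rewrite (ra (eq_sym (fmor_comp _ (assoc r l f) _))) iso_mor_inv fmor_id comp1m. }
have counitP X (g : hom (J X) B) :
  fmor (aext B) (counit adj ▷ g)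
      ∘ colax_comp_cell (MkColaxMorphism lbar) (MkColaxMorphism s) g
    = colax_id_cell g ∘ (counit adj ▷ aext B g) <->
  fmor (aext B) (post_counit adj g) ∘ lbar X (r · g) ∘ (l ◁ s X g)
    = post_counit adj (aext B g).
{ rewrite /colax_comp_cell /colax_id_cell /post_counit /= !fmor_comp !compmA.
  split=> [e | e].
  - apply: (iso_epic (i := assoc l r (aext B g))).
    apply: (iso_monic (i := iso_fmor (aext B) (iso_sym (lunit g)))) => /=.
    rewrite !compmA iso_inv_mor compm1 -e.
    by rewrite (ra (eq_sym (fmor_comp _ (lunit g)^-1 _))) iso_inv_mor fmor_id comp1m.
  - apply: (iso_monic (i := iso_fmor (aext B) (lunit g))).
    apply: (iso_epic (i := iso_sym (assoc l r (aext B g)))) => /=.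
    rewrite !compmA iso_mor_inv compm1 e.
    by rewrite (ra (eq_sym (fmor_comp _ (lunit g) _))) iso_mor_inv fmor_id comp1m. }
split=> [[adj' [eu ec]] | [U C]].
- split=> X f.
  + by apply/unitP; rewrite -eu; apply: (colaxtr_law (unit adj')).
  + by apply/counitP; rewrite -ec; apply: (colaxtr_law (counit adj')).
- pose nu := Build_ColaxTransformation (h := colax_id A)
    (h' := colax_comp (MkColaxMorphism s) (MkColaxMorphism lbar))
    (fun X f => proj2 (unitP X f) (U X f)).
  pose ep := Build_ColaxTransformation (h' := colax_id B)
    (h := colax_comp (MkColaxMorphism lbar) (MkColaxMorphism s))
    (fun X f => proj2 (counitP X f) (C X f)).
  unshelve eexists.
  + apply: (@Build_Adjunction (PsAlg_c T) A B (MkColaxMorphism lbar) (MkColaxMorphism s) nu ep).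
    * by apply: colaxtr_eq; apply: adj_triangle_l.
    * by apply: colaxtr_eq; apply: adj_triangle_r.
  + by [].
Qed.

Variables (lbar : ColaxStructure l) (rbar : LaxStructure r).
Hypothesis lbar_rbar : mates adj lbar rbar.

(** Both sides are transposes: [colax_mate] composes [l ◁ -] of the right side with
    the counit, which is transposition back from [r] to [l]. *)
Lemma mates_unit X (f : hom (J X) A) :
  (r ◁ lbar X f) ∘ post_unit adj (aext A f)
  = rbar X (l · f) ∘ fmor (aext A) (post_unit adj f).
Proof.
apply/post_transpose; rewrite (proj1 lbar_rbar).
by rewrite /colax_mate lwhisk_comp /post_counit !compmA.
Qed.

Lemma mates_counit X (g : hom (J X) B) :
  post_counit adj (aext B g) ∘ (l ◁ rbar X g)
  = fmor (aext B) (post_counit adj g) ∘ lbar X (r · g).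
Proof.
symmetry; apply/post_transpose; rewrite (proj2 lbar_rbar).
by rewrite /lax_mate lwhisk_comp /post_unit !compmA.
Qed.

Lemma is_lax_lift_iff (s : LaxStructure l) :
  is_lax_lift adj rbar s <-> forall X (f : hom (J X) A), inverse_of (s X f) (lbar X f).
Proof.
have unit_iff X (f : hom (J X) A) :
  (r ◁ s X f) ∘ rbar X (l · f) ∘ fmor (aext A) (post_unit adj f)
    = post_unit adj (aext A f) <-> s X f ∘ lbar X f = idm _.
  by rewrite -mates_unit (ra (eq_sym (lwhisk_comp _ _ _))); apply: post_unit_cancel.
rewrite is_lax_liftP; split=> [[U C] X f | inv].
- split; last exact/unit_iff.
  (* The counit condition only reaches cells of the form [s (r · g)]; naturality
     along the unit of postcomposition brings [s f] to [s (r · (l · f))]. *)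
  have -> : lbar X f = post_counit adj (aext B (l · f))
    ∘ (l ◁ (rbar X (l · f) ∘ fmor (aext A) (post_unit adj f))).
    exact/post_transpose/mates_unit.
  rewrite compmA lwhisk_comp [_ ∘ s X f](compmA (l ◁ _)) -lax_nat (ra3 (C _ _)).
  by rewrite -fmor_comp post_triangle_l fmor_id.
- split=> X f; first by apply/unit_iff; case: (inv X f).
  by rewrite (ra (mates_counit f)) compmA (proj1 (inv X (r · f))) compm1.
Qed.

Lemma is_colax_lift_iff (s : ColaxStructure r) :
  is_colax_lift adj lbar s <-> forall X (g : hom (J X) B), inverse_of (s X g) (rbar X g).
Proof.
have counit_iff X (g : hom (J X) B) :
  fmor (aext B) (post_counit adj g) ∘ lbar X (r · g) ∘ (l ◁ s X g)
    = post_counit adj (aext B g) <-> rbar X g ∘ s X g = idm _.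
  by rewrite (ra (eq_sym (mates_counit g))) compmA -lwhisk_comp; apply: post_counit_cancel.
rewrite is_colax_liftP; split=> [[U C] X g | inv].
- split; first exact/counit_iff.
  (* Here naturality is used along the counit of postcomposition. *)
  have <- : (r ◁ (fmor (aext B) (post_counit adj g) ∘ lbar X (r · g)))
    ∘ post_unit adj (aext A (r · g)) = rbar X g.
    by apply/post_transpose; rewrite mates_counit.
  rewrite lwhisk_comp !compmA (ra (colax_nat _ _)) !compmA U.
  by rewrite -fmor_comp post_triangle_r fmor_id.
- split=> X g; last by apply/counit_iff; case: (inv X g).
  by rewrite mates_unit (ra (proj2 (inv X (l · g)))) comp1m.
Qed.

End Lifts.

Theorem proposition4p2 (D E : Bicategory) (J : Pseudofunctor D E) (T : RelPseudomonad J)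
    (A B : Pseudoalgebra T) (l : hom A B) (r : hom B A) (adj : Adjunction l r)
    (lbar : ColaxStructure l) (rbar : LaxStructure r) (lbar_rbar : mates adj lbar rbar) :
  (lifts_to_PsAlg_l adj rbar <-> colax_is_pseudo lbar)
  /\ (lifts_to_PsAlg_c adj lbar <-> lax_is_pseudo rbar)
  /\ (forall s : LaxStructure l, is_lax_lift adj rbar s ->
        forall (X : D) (f : hom (J X) A), inverse_of (s X f) (lbar X f))
  /\ (forall s : ColaxStructure r, is_colax_lift adj lbar s ->
        forall (X : D) (g : hom (J X) B), inverse_of (s X g) (rbar X g)).
Proof.
have lax_iff := is_lax_lift_iff lbar_rbar.
have colax_iff := is_colax_lift_iff lbar_rbar.
split; [|split; [|split]].
- by rewrite colax_is_pseudo_iff; split=> -[s] /lax_iff; exists s.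
- by rewrite lax_is_pseudo_iff; split=> -[s] /colax_iff; exists s.
- by move=> s /lax_iff.
- by move=> s /colax_iff.
Qed.
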